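(* Let $G(\lambda)=CA(\lambda)^{-1}B+D(\lambda)$, where $A(\lambda)=\sum_{j=0}^m\lambda^jA_j\in\mathbb{C}[\lambda]^{n\times n}$ is regular of degree $m\ge 1$, $D(\lambda)=\sum_{j=0}^k\lambda^jD_j\in\mathbb{C}[\lambda]^{r\times r}$ has degree $k\ge1$, $C\in\mathbb{C}^{r\times n}$ and $B\in\mathbb{C}^{n\times r}$. Let $$\mathbb{L}(\lambda)=\left[\begin{array}{c|c} L_A(\lambda) & e_{m-i_0(\sigma_1,\sigma)}e^T_{k-c_0(\gamma,\gamma_2)}\otimes(-B)\\ \hline e_{k-i_0(\gamma_1,\gamma)}e^T_{m-c_0(\sigma,\sigma_2)}\otimes C & L_D(\lambda)\end{array}\right]$$ be a generalized Fiedler pencil with repetition (GFPR) of $G(\lambda)$, with $$L_A(\lambda)=M_{(\tau_1,\sigma_1)}(Y_1^A,X_1^A)\left(\lambda M^A_{\tau}-M^A_{\sigma}\right)M_{(\sigma_2,\tau_2)}(X_2^A,Y_2^A),$$ $$L_D(\lambda)=N_{(\delta_1,\gamma_1)}(Y_1^D,X_1^D)\left(\lambda N^D_{\delta}-N^D_{\gamma}\right)N_{(\gamma_2,\delta_2)}(X_2^D,Y_2^D),$$ where all the matrix assignments $X^A_j,Y^A_j,X^D_j,Y^D_j$ ($j=1,2$) are nonsingular. Then $\mathbb{L}(\lambda)$ is a Rosenbrock linearization of $G(\lambda)$.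
   Context: Elementary matrices. For $P\in\mathbb{C}^{n\times n}$ define $mn\times mn$ matrices $M_0(P)=\mathrm{diag}(I_{(m-1)n},P)$, $M_{-m}(P)=\mathrm{diag}(P,I_{(m-1)n})$, and for $i=1,\dots,m-1$: $M_i(P)=\mathrm{diag}\left(I_{(m-i-1)n},\begin{bmatrix}P&I_n\\ I_n&0\end{bmatrix},I_{(i-1)n}\right)$, $M_{-i}(P)=\mathrm{diag}\left(I_{(m-i-1)n},\begin{bmatrix}0&I_n\\ I_n&P\end{bmatrix},I_{(i-1)n}\right)$. Set $M_i^A=M_i(-A_i)$ for $i=0,\dots,m-1$ and $M_i^A=M_i(A_{-i})$ for $i=-1,\dots,-m$. The $kr\times kr$ matrices $N_i(P)$, $P\in\mathbb{C}^{r\times r}$, $i\in\{-k,\dots,k-1\}$, and $N_i^D$ are defined in the same way with $(m,n,A)$ replaced by $(k,r,D)$. Index tuples and matrix assignments. An index tuple is a finite (possibly empty) ordered tuple of integers; $(s,t)$ denotes concatenation of tuples $s,t$. For $p=(p_1,\dots,p_s)$ with entries in $\{-m,\dots,m-1\}$, a matrix assignment for $p$ is a tuple $P=(P_1,\dots,P_s)$ of $n\times n$ matrices, and $M_p(P)=M_{p_1}(P_1)\cdots M_{p_s}(P_s)$ (the identity if $p$ is empty); $M_{(p,q)}(P,Q)=M_p(P)M_q(Q)$; $M^A_p=M^A_{p_1}\cdots M^A_{p_s}$. The assignment $P$ is nonsingular if every $P_j$ with $p_j\in\{0,-m\}$ is nonsingular. Similarly for $N$, with $r\times r$ matrices, indices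 in $\{-k,\dots,k-1\}$, and special indices $0,-k$. A permutation of a finite set is viewed as a tuple listing each element exactly once. SIP. A tuple $(j_1,\dots,j_p)$ of nonnegative integers satisfies the Successor Infix Property (SIP) if whenever $j_s=j_t$ with $s<t$ there is $s<q<t$ with $j_q=j_s+1$. A tuple with entries in $\{-h,\dots,-1\}$ satisfies the SIP if the tuple obtained by adding $h$ to all entries does. Consecutions and inversions. A subtuple is obtained by deleting some (possibly no) entries, keeping the order. For a tuple $\gamma$ of nonnegative integers containing $0$, $c_0(\gamma)$ is the largest $s$ such that $(0,1,\dots,s)$ is a subtuple of $\gamma$, and $i_0(\gamma)$ is the largest $s$ such that $(s,\dots,1,0)$ is a subtuple of $\gamma$. GFPR. $\mathbb{L}(\lambda)$ of the displayed form is a GFPR of $G(\lambda)$ when: for some $h\in\{0,\dots,m-1\}$, $\sigma$ is a permutation of $\{0,\dots,h\}$, $\tau$ is a permutation of $\{-m,\dots,-h-1\}$, $\sigma_1,\sigma_2$ are index tuples with entries from $\{0,\dots,h-1\}$ with $(\sigma_1,\sigma,\sigma_2)$ satisfying the SIP, $\tau_1,\tau_2$ are index tuples with entries from $\{-m,\dots,-h-2\}$ with $(\tau_1,\tau,\tau_2)$ satisfying the SIP, and $X_1^A,X_2^A,Y_1^A,Y_2^A$ are matrix assignments for $\sigma_1,\sigma_2,\tau_1,\tau_2$ respectively; and for some $\ell\in\{0,\dots,k-1\}$, $\gamma$ is a permutation of $\{0,\dots,\ell\}$, $\delta$ is a permutation of $\{-k,\dots,-\ell-1\}$, $\gamma_1,\gamma_2$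 have entries from $\{0,\dots,\ell-1\}$ with $(\gamma_1,\gamma,\gamma_2)$ satisfying the SIP, $\delta_1,\delta_2$ have entries from $\{-k,\dots,-\ell-2\}$ with $(\delta_1,\delta,\delta_2)$ satisfying the SIP, and $X_1^D,X_2^D,Y_1^D,Y_2^D$ are matrix assignments for $\gamma_1,\gamma_2,\delta_1,\delta_2$ respectively. $e_j$ denotes the $j$-th standard basis (column) vector, of $\mathbb{C}^m$ when written $e_{m-\cdot}$ and of $\mathbb{C}^k$ when written $e_{k-\cdot}$; $\otimes$ is the Kronecker product. Rosenbrock linearization. The system matrix of $G$ is $\mathcal{S}(\lambda)=\begin{bmatrix}A(\lambda)&-B\\ C&D(\lambda)\end{bmatrix}$. A pencil $\mathbb{L}(\lambda)$ of size $mn+kr$ is a Rosenbrock linearization of $G(\lambda)$ (equivalently of $\mathcal{S}(\lambda)$) if there are unimodular matrix polynomials $U_A,V_A$ of size $mn$ and $U_D,V_D$ of size $kr$ with $$\mathrm{diag}(U_A(\lambda),U_D(\lambda))\,\mathbb{L}(\lambda)\,\mathrm{diag}(V_A(\lambda),V_D(\lambda))=\mathrm{diag}(I_{(m-1)n},\mathcal{S}(\lambda),I_{(k-1)r}).$$ *)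

(* Defs.v *)
From HB Require Import structures.
From mathcomp Require Import all_boot all_order all_algebra.
From mathcomp Require Import reals zify.
From mathcomp.real_closed Require Import complex mxtens.

Set Implicit Arguments.
Unset Strict Implicit.
Unset Printing Implicit Defensive.

Import Order.TTheory GRing.Theory Num.Theory.
Local Open Scope ring_scope.

Section Matrices.
Variable F : nzRingType.

Definition bdiag (a b : nat) (P : 'M[F]_a) (Q : 'M[F]_b) : 'M[F]_(a + b) :=
  block_mx P 0 0 Q.

(* The [conform_mx 0] only transports the block matrix along the equality of
   its size with m * n; see [elem_mx_size0] and [elem_mx_size]. The value for
   an index i outside {-m, ..., m-1} is irrelevant. *)
Definition elem_mx (m n : nat) (i : int) (P : 'M[F]_n) : 'M[F]_(m * n) :=
  let j := `|i|%N in
  if i == 0 then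
    conform_mx 0 (bdiag (1%:M : 'M_((m - 1) * n)) P)
  else if i == - m%:Z then
    conform_mx 0 (bdiag P (1%:M : 'M_((m - 1) * n)))
  else if 0 < i then
    conform_mx 0 (bdiag (1%:M : 'M_((m - j - 1) * n))
                    (bdiag (block_mx P 1%:M 1%:M 0)
                       (1%:M : 'M_((j - 1) * n))))
  else
    conform_mx 0 (bdiag (1%:M : 'M_((m - j - 1) * n))
                    (bdiag (block_mx 0 1%:M 1%:M P)
                       (1%:M : 'M_((j - 1) * n)))).

Lemma elem_mx_size0 (m n : nat) : (0 < m)%N ->
  ((m - 1) * n + n = m * n)%N /\ (n + (m - 1) * n = m * n)%N.
Proof. by case: m => // m _; rewrite subn1 /= mulSn addnC. Qed.

Lemma elem_mx_size (m n j : nat) : (0 < j < m)%N ->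
  ((m - j - 1) * n + ((n + n) + (j - 1) * n) = m * n)%N.
Proof.
move=> j_lt; have -> : (n + n = 2 * n)%N by rewrite mul2n addnn.
by rewrite -!mulnDl; congr (_ * n)%N; lia.
Qed.

Definition elem_prod (m n : nat) (p : seq int) (P : seq 'M[F]_n) :
    'M[F]_(m * n) :=
  \big[mulmx/1%:M]_(x <- zip p P) elem_mx m x.1 x.2.

Definition coef_at (n : nat) (A : nat -> 'M[F]_n) (i : int) : 'M[F]_n :=
  if 0 <= i then - A `|i|%N else A `|i|%N.

Definition elem_prod_coef (m n : nat) (A : nat -> 'M[F]_n) (p : seq int) :
    'M[F]_(m * n) :=
  elem_prod m p [seq coef_at A i | i <- p].

(* e_p with 1-based index p *)
Definition std_col (N p : nat) : 'cV[F]_N := \col_(i < N) (i.+1 == p)%:R.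

End Matrices.

Definition SIP (j : seq int) : Prop :=
  forall s t : nat, (s < t < size j)%N -> j`_s = j`_t ->
    exists2 q : nat, (s < q < t)%N & j`_q = j`_s + 1.

(* for tuples with entries in {-h, ..., -1} *)
Definition SIP_neg (h : nat) (j : seq int) : Prop :=
  SIP [seq x + h%:Z | x <- j].

Definition consecutions0 (g : seq int) : nat :=
  \max_(s < size g | subseq [seq i%:Z | i <- iota 0 s.+1] g) s.

Definition inversions0 (g : seq int) : nat :=
  \max_(s < size g | subseq (rev [seq i%:Z | i <- iota 0 s.+1]) g) s.

Section GFPR.
Variable F : fieldType.

Definition matpoly (d n : nat) (A : nat -> 'M[F]_n) : 'M[{poly F}]_n :=
  \sum_(j < d.+1) 'X^j *: map_mx polyC (A j).

Definition is_assignment (n : nat) (p : seq int) (P : seq 'M[F]_n) : Prop :=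
  size P = size p.

Definition nonsingular_assignment (m n : nat) (p : seq int) (P : seq 'M[F]_n) :
    Prop :=
  forall a : nat, (a < size p)%N -> p`_a \in [:: 0; - m%:Z] ->
    P`_a \in unitmx.

(* The index tuples s1, s, s2, t1, t, t2 and the assignments x1, x2, y1, y2
   stand for sigma_1, sigma, sigma_2, tau_1, tau, tau_2, X_1, X_2, Y_1, Y_2
   (or for their counterparts on the D side). *)
Record gfpr_data (m n h : nat) (s t s1 s2 t1 t2 : seq int)
    (x1 x2 y1 y2 : seq 'M[F]_n) : Prop := GfprData {
  gfpr_h : (h < m)%N;
  gfpr_s : perm_eq s [seq j%:Z | j <- iota 0 h.+1];
  gfpr_t : perm_eq t [seq - j%:Z | j <- iota h.+1 (m - h)];
  gfpr_s1 : {in s1, forall i : int, 0 <= i <= h%:Z - 1};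
  gfpr_s2 : {in s2, forall i : int, 0 <= i <= h%:Z - 1};
  gfpr_sip_s : SIP (s1 ++ s ++ s2);
  gfpr_t1 : {in t1, forall i : int, - m%:Z <= i <= - h%:Z - 2};
  gfpr_t2 : {in t2, forall i : int, - m%:Z <= i <= - h%:Z - 2};
  gfpr_sip_t : SIP_neg m (t1 ++ t ++ t2);
  gfpr_x1 : is_assignment s1 x1;
  gfpr_x2 : is_assignment s2 x2;
  gfpr_y1 : is_assignment t1 y1;
  gfpr_y2 : is_assignment t2 y2
}.

Definition gfpr_diag (m n : nat) (A : nat -> 'M[F]_n)
    (s t s1 s2 t1 t2 : seq int) (x1 x2 y1 y2 : seq 'M[F]_n) :
    'M[{poly F}]_(m * n) :=
  map_mx polyC (elem_prod m (t1 ++ s1) (y1 ++ x1))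
  *m ('X *: map_mx polyC (elem_prod_coef m A t)
      - map_mx polyC (elem_prod_coef m A s))
  *m map_mx polyC (elem_prod m (s2 ++ t2) (x2 ++ y2)).

Definition system_matrix (m n k r : nat) (A : nat -> 'M[F]_n)
    (B : 'M[F]_(n, r)) (C : 'M[F]_(r, n)) (D : nat -> 'M[F]_r) :
    'M[{poly F}]_(n + r) :=
  block_mx (matpoly m A) (map_mx polyC (- B))
           (map_mx polyC C) (matpoly k D).

Definition is_pencil (N : nat) (L : 'M[{poly F}]_N) : Prop :=
  forall i j, (size (L i j) <= 2)%N.

(* Membership in [unitmx] over {poly F} means that the determinant is a nonzero
   constant, i.e. that the matrix polynomial is unimodular. As in [elem_mx],
   [conform_mx 0] is a mere change of size, see [rosenbrock_size]. *)
Definition rosenbrock_linearization (m n k r : nat) (A : nat -> 'M[F]_n)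
    (B : 'M[F]_(n, r)) (C : 'M[F]_(r, n)) (D : nat -> 'M[F]_r)
    (L : 'M[{poly F}]_(m * n + k * r)) : Prop :=
  is_pencil L /\
  exists (UA VA : 'M[{poly F}]_(m * n)) (UD VD : 'M[{poly F}]_(k * r)),
    [/\ UA \in unitmx, VA \in unitmx, UD \in unitmx, VD \in unitmx &
      bdiag UA UD *m L *m bdiag VA VD =
      conform_mx 0
        (bdiag (1%:M : 'M_((m - 1) * n))
           (bdiag (system_matrix m k A B C D) (1%:M : 'M_((k - 1) * r))))].

Lemma rosenbrock_size (m n k r : nat) : (0 < m)%N -> (0 < k)%N ->
  ((m - 1) * n + ((n + r) + (k - 1) * r) = m * n + k * r)%N.
Proof.
case: m k => // m [//|k] _ _.
by rewrite !subn1 /= !mulSn -addnA addnCA addnA.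
Qed.

End GFPR.

(* Main.v *)
Require Import Defs.
From HB Require Import structures.
From mathcomp Require Import all_boot all_order all_algebra.
From mathcomp Require Import reals zify.
From mathcomp.real_closed Require Import complex mxtens.

(** Write M_i for the elementary factors of A, e_j for the j-th block column of
the identity, and u = e_(m - i0(sigma1, sigma)), v = e_(m - c0(sigma, sigma2))
for the block vectors that carry B and C.  Everything follows from a statement
about A alone, applied once to A and once to D:

  L_A = S T + u P v^T, with P = A(lambda), and with the square matrices
  [u S] and [v^T ; T] unimodular.

This is the predicate [reduces_to].  Multiplying by the inverses of the two
frames turns L_A into diag(P, I), u into the first block column of the identity
and v^T into the first block row, so the off-diagonal blocks of the pencil
become a single block -B and a single block C.  The two blocks of the A frames
are swapped to put P last, those of the D frames are not, and the four blocks of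
the system matrix meet in the middle ([assemble]).

The statement for A is proved by two reductions.

From a GFPR to a Fiedler pencil ([gfpr_reduces]).  Write tau = (a, -m, b).  As
M_(-i)^A is inverse to M_i^A for 0 < i < m, factoring M_a^A and M_b^A out of
lambda M_tau^A - M_sigma^A leaves lambda M_(-m)^A - M_rho^A, where
rho = (rev(-a), sigma, rev(-b)) is a permutation of 0, ..., m-1.  All the factors
taken out are invertible constants; what has to be checked is their action on u
and v.  A factor M_i with i >= 0 maps e_(m-s) to e_(m-s-1) if i = s+1, fixes it
if i is neither s nor s+1, and spoils it if i = s.  When i is put in front of a
tuple t with i0(t) = s, this is exactly how i0 changes, and the SIP excludes the
bad case ([elem_prod_block_unit]).  The factors with indices below -h-1 act on
the top blocks and fix u and v ([elem_prod_neg_fix]).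

Fiedler pencils ([fiedler_reduces]).  Induction on m.  The largest index m-1
commutes with every index but m-2, so it can be moved to one end of rho; up to
transposition, to the left.  Dividing by M_(m-1) leaves a pencil whose leading
block is -I, and the Schur complement of this block is the Fiedler pencil of
size m-1 in which A_(m-1) is replaced by A_(m-1) + lambda A_m.  This leaves
A(lambda) unchanged.  The coefficients are then polynomials, which is why the
induction runs over an arbitrary commutative ring with a marked element
lambda. *)

Set Implicit Arguments.
Unset Strict Implicit.
Unset Printing Implicit Defensive.

Import Order.TTheory GRing.Theory Num.Theory.
Local Open Scope ring_scope.

(** * Staircases in index tuples *)

(** Reading a tuple from right to left, [stair] counts how many of the values
0, 1, 2, ... are met in this order.  The greedy choice is optimal, so this is
i0 + 1 when 0 occurs.  It is computed one entry at a time, which matches the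
action of a product of elementary matrices on a block vector. *)
Definition stair_step (i : int) (c : nat) : nat :=
  if i == c%:Z then c.+1 else c.

Definition stair (t : seq int) : nat := foldr stair_step 0%N t.

Lemma stair_cons i t : stair (i :: t) = stair_step i (stair t).
Proof. by []. Qed.

Lemma stair_cat s t : stair (s ++ t) = foldr stair_step (stair t) s.
Proof. by rewrite /stair foldr_cat. Qed.

Definition descent (c : nat) : seq int := rev [seq i%:Z | i <- iota 0 c].

Lemma descentS c : descent c.+1 = c%:Z :: descent c.
Proof. by rewrite /descent -addn1 iotaD map_cat rev_cat. Qed.

Lemma subseq_descent c t : subseq (descent c) t = (c <= stair t)%N.
Proof.
elim: t c => [|y t IH] c.
  by case: c => [|c] //; rewrite descentS.
case: c => [|c]; first by rewrite leq0n; exact: sub0seq.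
rewrite stair_cons /stair_step descentS /=; case: (c%:Z =P y) => [<-|ne].
  rewrite IH; case: eqP => [[->]|ne]; first by rewrite !ltnS.
  by rewrite ltn_neqAle; case: eqP => // e; case: ne; rewrite e.
rewrite -descentS IH; case: eqP => [e|_] //.
have {}ne : c <> stair t by move=> e'; apply: ne; rewrite e e'.
by rewrite ltnS ltn_neqAle; case: eqP.
Qed.

Lemma stair_le_size t : (stair t <= size t)%N.
Proof.
by elim: t => //= i t IH; rewrite /stair_step; case: ifP => _; rewrite ?ltnS ?leqW.
Qed.

Lemma inversions0_stair t : inversions0 t = (stair t).-1.
Proof.
rewrite /inversions0.
under eq_bigl => i do rewrite -/(descent i.+1) subseq_descent.
apply/eqP; rewrite eqn_leq; apply/andP; split.
  by apply/bigmax_leqP => i lt_i; rewrite -ltnS (leq_trans lt_i) // leqSpred.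
case E: (stair t) => [|c] //=.
have lt_c : (c < size t)%N by rewrite -E stair_le_size.
exact: (leq_bigmax_cond (Ordinal lt_c)).
Qed.

Lemma consecutions0_rev t : consecutions0 t = inversions0 (rev t).
Proof.
rewrite /consecutions0 /inversions0 size_rev.
by apply: eq_bigl => i; rewrite subseq_rev.
Qed.

Lemma stair_gt0 t : 0 \in t -> (0 < stair t)%N.
Proof. by rewrite -subseq_descent -sub1seq. Qed.

Lemma stair_le t h : {in t, forall i, i < h%:Z} -> (stair t <= h)%N.
Proof.
elim: t => //= i t IH lt_h; rewrite /stair_step.
have {}IH : (stair t <= h)%N by apply: IH => j jt; rewrite lt_h // in_cons jt orbT.
case: eqP => // e; have := lt_h i (mem_head _ _); rewrite e; lia.
Qed.

Lemma stair_catr s t : 0 \notin t -> stair (s ++ t) = stair s.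
Proof.
move=> t0; rewrite stair_cat; suff -> : stair t = 0%N by [].
by case: (posnP (stair t)) => //; rewrite -subseq_descent sub1seq (negPf t0).
Qed.

(** Two different entries that are not neighbouring integers can be exchanged
without changing the count, as the corresponding matrices commute. *)
Lemma stair_shift (j : nat) a b :
    (0 < j)%N -> {in a, forall i, i != j%:Z - 1 /\ i != j%:Z + 1} ->
  stair (a ++ j%:Z :: b) = stair (j%:Z :: a ++ b).
Proof.
move=> j0; elim: a => //= i a IH ai.
rewrite -/(stair _) IH; last by move=> x xa; apply: ai; rewrite in_cons xa orbT.
have [ne1 ne2] := ai i (mem_head _ _); rewrite /= -/(stair (a ++ b)) /stair_step.
move: (stair _) => c.
by case: (j%:Z =P c) => ?; case: (i =P c) => ?; repeat case: ifP => ?; lia.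
Qed.

(** The entries on the right of j + 1 lead the count to j at most, so that j + 1 is
not the next awaited value. *)
Lemma stair_drop (j : nat) a b : {in b, forall i, i < j%:Z} ->
  stair (a ++ j.+1%:Z :: b) = stair (a ++ b).
Proof.
move=> /stair_le le_b; rewrite !stair_cat /= -/(stair b) /stair_step.
by case: eqP => // [[e]]; move: le_b; rewrite -e ltnn.
Qed.

Lemma SIP_behead i t : SIP (i :: t) -> SIP t.
Proof.
move=> sip x y /andP[xy yt] e.
have := sip x.+1 y.+1; rewrite /= !ltnS xy yt => /(_ isT e) [[|q]] //.
by rewrite !ltnS => lt_q eq_q; exists q.
Qed.

Lemma SIP_rev t : SIP t -> SIP (rev t).
Proof.
move=> sip x y; rewrite size_rev => /andP[xy yt].
rewrite !nth_rev ?(ltn_trans xy) // => e.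
have [||q lt_q eq_q] := sip (size t - y.+1)%N (size t - x.+1)%N.
- by lia.
- by rewrite e.
exists (size t - q.+1)%N; first by lia.
have {lt_q} [q_lt qK] : (size t - q.+1 < size t)%N /\ (size t - (size t - q.+1).+1 = q)%N.
  by move: (size t) lt_q yt => N; lia.
by rewrite nth_rev // qK eq_q e.
Qed.

Lemma SIP_catl s t : SIP (s ++ t) -> SIP s.
Proof.
move=> sip x y /andP[xy ys] e.
have xs := ltn_trans xy ys.
have [||q lt_q] := sip x y.
- by rewrite xy size_cat ltn_addr.
- by rewrite !nth_cat ys xs.
have qs : (q < size s)%N by lia.
by rewrite !nth_cat qs xs => eq_q; exists q.
Qed.

Lemma SIP_catr s t : SIP (s ++ t) -> SIP t.
Proof. by elim: s => //= i s IH /SIP_behead. Qed.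

Lemma uniq_SIP t : uniq t -> SIP t.
Proof.
move=> /uniqP ut x y /andP[xy yt] e.
have /ut := e; rewrite !inE (ltn_trans xy yt) yt => /(_ isT isT) exy.
by move: xy; rewrite exy ltnn.
Qed.

(** The case in which an elementary matrix would not map a block vector of the
identity to another one.  If i equals the top s of the staircase of t, the SIP
provides s + 1 before the first s in t; this s + 1 followed by the staircase
from s down to 0 would make a longer one. *)
Lemma SIP_stair i t : SIP (i :: t) -> (0 < stair t)%N -> i <> (stair t).-1%:Z.
Proof.
case E: (stair t) => [|c] // sip _ /= ic.
have sub_t : subseq (descent c.+1) t by rewrite subseq_descent E.
have ct : c%:Z \in t by rewrite (mem_subseq sub_t) // descentS mem_head.
pose k := index c%:Z t.
have kt : (k < size t)%N by rewrite index_mem.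
have [||q /andP[q0 qk] eq_q] := sip 0%N k.+1; rewrite /= ?nth_index //.
case: q q0 qk eq_q => //= q _; rewrite ltnS => qk eq_q.
have : subseq (descent c.+2) t; last by rewrite subseq_descent E ltnn.
rewrite -(cat_take_drop k t) descentS -cat1s; apply: cat_subseq.
  rewrite sub1seq; have -> : c.+1%:Z = nth 0 (take k t) q.
    by rewrite nth_take // eq_q ic; lia.
  by rewrite mem_nth // size_takel // ltnW.
move: sub_t; rewrite -{1}(cat_take_drop k t).
have : c%:Z \notin take k t.
  apply/negP => /(nthP 0) [x]; rewrite size_takel ?(ltnW kt) // => xk.
  by rewrite nth_take // => /eqP; have /= -> := before_find 0 xk.
rewrite descentS; elim: (take k t) => //= y s IH.
by rewrite inE negb_or => /andP[/negPf-> /IH].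
Qed.

Definition nat_range (a b : nat) : seq int := [seq j%:Z | j <- iota a b].

Lemma mem_nat_range m (i : int) : (i \in nat_range 0 m) = (0 <= i < m%:Z).
Proof.
apply/mapP/idP => [[j]|im]; first by rewrite mem_iota => jm ->; lia.
by exists `|i|%N; rewrite ?mem_iota; lia.
Qed.

Lemma uniq_nat_range a b : uniq (nat_range a b).
Proof. by rewrite map_inj_uniq ?iota_uniq // => x y []. Qed.

(** * Block shapes of the elementary matrices *)

Section Blocks.
Variable K : nzRingType.

Lemma conform_castE a b (e : a = b) (B : 'M[K]_b) (X : 'M[K]_a) :
  conform_mx B X = castmx (e, e) X.
Proof. by case: b / e B => B; rewrite castmx_id conform_mx_id. Qed.

Lemma conform_mulmx a b (X Y : 'M[K]_a) : a = b ->
  (conform_mx 0 X : 'M_b) *m (conform_mx 0 Y : 'M_b) = conform_mx 0 (X *m Y).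
Proof. by case: b /; rewrite !conform_mx_id. Qed.

Lemma conform_mx1 a b : a = b ->
  conform_mx 0 (1%:M : 'M[K]_a) = 1%:M :> 'M_b.
Proof. by case: b /; rewrite conform_mx_id. Qed.

Lemma bdiag1 a b : bdiag 1%:M 1%:M = 1%:M :> 'M[K]_(a + b).
Proof. by rewrite /bdiag -scalar_mx_block. Qed.

Lemma bdiagM a b (P P' : 'M[K]_a) (Q Q' : 'M[K]_b) :
  bdiag P Q *m bdiag P' Q' = bdiag (P *m P') (Q *m Q').
Proof.
by rewrite /bdiag mulmx_block !mul0mx !mulmx0 !addr0 !add0r.
Qed.

(** Reassociation of a block diagonal matrix whose identity block is cut into two;
this is how the top block is split off from an elementary matrix. *)
Lemma conform_peel n a a' b N (Q : 'M[K]_b) : a' = (n + a)%N -> (a + b = N)%N ->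
  conform_mx 0 (bdiag (1%:M : 'M_a') Q)
  = bdiag (1%:M : 'M_n) (conform_mx 0 (bdiag (1%:M : 'M_a) Q)) :> 'M[K]_(n + N).
Proof.
move=> ->; case: N /; rewrite conform_mx_id (conform_castE (esym (addnA n a b))).
have /= := @block_mxAx _ n a b n a b 1%:M 0 0 0 1%:M 0 0 0 Q.
rewrite /bdiag scalar_mx_block !row_mx0 !col_mx0 => ->.
exact: eq_castmx.
Qed.

(** The shape of the factor of largest index and of its inverse, bracketed so that
the first block row and column can be split off. *)
Definition top_mx n c (P Q R S : 'M[K]_n) : 'M_(n + (n + c)) :=
  block_mx P (row_mx Q 0) (col_mx R 0) (bdiag S 1%:M).

Lemma conform_top n a c (P Q R S : 'M[K]_n) : a = 0%N ->
  conform_mx 0 (bdiag (1%:M : 'M_a) (bdiag (block_mx P Q R S) (1%:M : 'M_c)))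
  = top_mx c P Q R S.
Proof.
move=> ->.
have e : (0 + (n + n + c) = n + (n + c))%N by rewrite add0n addnA.
rewrite (conform_castE e).
have -> : bdiag (1%:M : 'M_0) (bdiag (block_mx P Q R S) (1%:M : 'M_c)) =
   bdiag (block_mx P Q R S) (1%:M : 'M_c).
  apply/matrixP => i j; have e0 (x : 'I_(n + n + c)) : x = rshift 0 x :> 'I_(0 + (n + n + c)).
    exact: val_inj.
  by rewrite [in LHS](e0 i) [in LHS](e0 j) block_mxEdr.
rewrite /top_mx /bdiag block_mxA !row_mx0 !col_mx0.
by apply: eq_castmx.
Qed.

Lemma top_mxM n c (P Q R S P' Q' R' S' : 'M[K]_n) :
  top_mx c P Q R S *m top_mx c P' Q' R' S' =
  top_mx c (P *m P' + Q *m R') (P *m Q' + Q *m S')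
           (R *m P' + S *m R') (R *m Q' + S *m S').
Proof.
rewrite /top_mx /bdiag mulmx_block mul_row_col mul_mx_row mul_row_block.
rewrite mul_col_row mul_col_mx mul_block_col mulmx_block.
rewrite !mul0mx !mulmx0 !addr0 !add0r add_row_mx addr0 add_col_mx addr0.
by rewrite add_block_mx !addr0 !add0r mul1mx.
Qed.

Lemma top_mx1 n c : top_mx c 1%:M 0 0 1%:M = 1%:M :> 'M[K]_(n + (n + c)).
Proof. by rewrite /top_mx row_mx0 col_mx0 bdiag1 -/(bdiag _ _) bdiag1. Qed.

Lemma elem_mx_peel (m n j : nat) (P : 'M[K]_n) : (j <= m)%N ->
  elem_mx m.+2 j P = bdiag 1%:M (elem_mx m.+1 j P).
Proof.
move=> jm; rewrite /elem_mx.
case: eqP => [e|/eqP j0].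
  by apply: conform_peel; rewrite !subn1 //= addnC.
have -> : (j%:Z == - m.+2%:Z) = false by lia.
have -> : (j%:Z == - m.+1%:Z) = false by lia.
have -> : 0 < j%:Z by lia.
rewrite absz_nat; apply: conform_peel; last by rewrite elem_mx_size //; lia.
by rewrite -mulSn; congr (_ * _)%N; lia.
Qed.

Lemma elem_mx_top (m n : nat) (P : 'M[K]_n) :
  elem_mx m.+2 m.+1 P = top_mx (m * n) P 1%:M 1%:M 0.
Proof.
rewrite /elem_mx /= (subn1 m.+1) /=.
by apply: conform_top; rewrite -subnDA addn1 subnn.
Qed.

Lemma elem_mx_last n (P : 'M[K]_n) :
  elem_mx 1 0 P = bdiag P (1%:M : 'M_(0 * n)).
Proof.
rewrite /elem_mx /= (conform_castE (esym (addn0 n))).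
apply/matrixP => i j; rewrite castmxE /=.
have e0 (x : 'I_(n + 0)) : exists y, x = lshift 0 y.
  by case: (split_ordP x) => [y->|[]] //; exists y.
have [x ->] := e0 i; have [y ->] := e0 j.
have e1 (z : 'I_n) : cast_ord (esym (esym (addn0 n))) (lshift 0 z) = rshift ((1 - 1) * n) z.
  exact: val_inj.
rewrite !e1 /bdiag.
exact: etrans (block_mxEdr _ _ _ _ x y) (esym (block_mxEul _ _ _ _ x y)).
Qed.

Lemma elem_mx_lead (m n : nat) (P : 'M[K]_n) :
  elem_mx m.+1 (- m.+1%:Z) P = bdiag P (1%:M : 'M_(m * n)).
Proof.
by rewrite /elem_mx /= eqxx subn1 /= -/(n + m * n)%N conform_mx_id.
Qed.

(** This is why M_(-i)^A is the inverse of M_i^A for 0 < i < m. *)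
Lemma elem_mxN (m n i : nat) (P : 'M[K]_n) : (0 < i < m)%N ->
  elem_mx m (- i%:Z) P *m elem_mx m i (- P) = 1%:M /\
  elem_mx m i (- P) *m elem_mx m (- i%:Z) P = 1%:M.
Proof.
move=> im; rewrite /elem_mx.
have -> : (i%:Z == 0) = false by lia.
have -> : (i%:Z == - m%:Z) = false by lia.
have -> : (0 < i%:Z) by lia.
have -> : (- i%:Z == 0) = false by lia.
have -> : (- i%:Z == - m%:Z) = false by lia.
have -> : (0 < - i%:Z) = false by lia.
rewrite abszN absz_nat.
split; rewrite conform_mulmx ?elem_mx_size // !bdiagM !mulmx1 mulmx_block;
  rewrite !mulmx1 !mul1mx !mulmx0 !mul0mx !addr0 !add0r ?subrr ?addNr;
  by rewrite -scalar_mx_block !bdiag1 conform_mx1 ?elem_mx_size.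
Qed.

Lemma tr_bdiag a b (P : 'M[K]_a) (Q : 'M[K]_b) :
  (bdiag P Q)^T = bdiag P^T Q^T.
Proof. by rewrite /bdiag tr_block_mx !trmx0. Qed.

Lemma tr_elem_mx m n i (P : 'M[K]_n) : (elem_mx m i P)^T = elem_mx m i P^T.
Proof.
rewrite /elem_mx; case: (i == 0); last case: (i == _); last case: (0 < i);
  by rewrite trmx_conform trmx0 !tr_bdiag ?tr_block_mx ?trmx1 ?trmx0.
Qed.

Lemma map_bdiag (K' : nzRingType) (f : {rmorphism K -> K'}) a b
  (P : 'M[K]_a) (Q : 'M[K]_b) :
  map_mx f (bdiag P Q) = bdiag (map_mx f P) (map_mx f Q).
Proof. by rewrite /bdiag map_block_mx !map_mx0. Qed.
End Blocks.

Lemma map_elem_mx (K K' : nzRingType) (f : {rmorphism K -> K'}) m n i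
  (P : 'M[K]_n) : map_mx f (elem_mx m i P) = elem_mx m i (map_mx f P).
Proof.
rewrite /elem_mx; case: (i == 0); last case: (i == _); last case: (0 < i);
  by rewrite map_conform_mx map_mx0 !map_bdiag ?map_block_mx ?map_mx1 ?map_mx0.
Qed.

(** * Action of the elementary matrices on block unit vectors *)

Section BlockUnit.
Variable K : nzRingType.

(** The block column e_(m-s) (x) I_n: the blocks are numbered by s from the bottom,
because i0 and c0 are, and because this number does not change when a block is
added or removed at the top. *)
Definition block_unit m n s : 'M[K]_(m * n, n) :=
  \matrix_(i, j) ((i %/ n + s.+1 == m) && (i %% n == j))%N%:R.

Lemma scalar_mx0 n : false%:R%:M = 0 :> 'M[K]_n.
Proof. by apply/matrixP => i j; rewrite !mxE mul0rn. Qed.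

Lemma block_unitS m n s :
  block_unit m.+1 n s = col_mx (s == m)%:R%:M (block_unit m n s).
Proof.
apply/matrixP => i j; rewrite -[_ i j]/((block_unit m.+1 n s : 'M_(n + m * n, n)) i j).
case: (split_ordP i) => x ->; rewrite ?col_mxEu ?col_mxEd !mxE /=.
  rewrite divn_small // modn_small // add0n eqSS.
  by case: (s == m); rewrite /= ?mul0rn // -val_eqE.
have n0 : (0 < n)%N by case: (n) j => [[]|].
by rewrite divnDl // divnn n0 modnDl add1n addSn eqSS.
Qed.

Lemma block_unit_ge m n s : (m <= s)%N -> block_unit m n s = 0.
Proof.
move=> ms; apply/matrixP => i j; rewrite !mxE.
by rewrite gtn_eqF // (leq_ltn_trans ms) // addnS ltnS leq_addl.
Qed.

Lemma bdiag_col a b c (P : 'M[K]_a) (Q : 'M_b) (x : 'M_(a, c)) (y : 'M_(b, c)) :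
  bdiag P Q *m col_mx x y = col_mx (P *m x) (Q *m y).
Proof. by rewrite /bdiag mul_block_col !mul0mx addr0 add0r. Qed.

Lemma top_mx_col n c d (P Q R S : 'M[K]_n) (x y : 'M_(n, d)) (z : 'M_(c, d)) :
  top_mx c P Q R S *m col_mx x (col_mx y z) =
  col_mx (P *m x + Q *m y) (col_mx (R *m x + S *m y) z).
Proof.
by rewrite /top_mx mul_block_col mul_row_col mul_col_mx bdiag_col add_col_mx
           !mul0mx mul1mx addr0 add0r.
Qed.

Lemma elem_mx_fix m n (i : nat) s (P : 'M[K]_n) :
    (i <= m)%N -> i <> s -> i <> s.+1 ->
  elem_mx m.+1 i P *m block_unit m.+1 n s = block_unit m.+1 n s.
Proof.
elim: m i => [|m IH] i im is_ iS.
  have -> : i = 0%N by lia.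
  rewrite elem_mx_last block_unitS bdiag_col mul1mx.
  have -> : (s == 0)%N = false by lia.
  by rewrite scalar_mx0 mulmx0.
rewrite block_unitS; have [le_im|lt_mi] := leqP i m.
  by rewrite elem_mx_peel // bdiag_col mul1mx IH.
have ei : i = m.+1 by lia.
rewrite ei elem_mx_top block_unitS top_mx_col !mul1mx mul0mx addr0.
have -> : (s == m.+1)%N = false by lia.
have -> : (s == m)%N = false by lia.
by rewrite !scalar_mx0 mulmx0 addr0.
Qed.

Lemma elem_mx_up m n s (P : 'M[K]_n) : (s < m)%N ->
  elem_mx m.+1 s.+1 P *m block_unit m.+1 n s = block_unit m.+1 n s.+1.
Proof.
elim: m => // m IH; rewrite ltnS leq_eqVlt => /predU1P[->|sm]; last first.
  rewrite block_unitS elem_mx_peel // bdiag_col mul1mx IH //.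
  rewrite [in RHS]block_unitS; congr (col_mx (_ : bool)%:R%:M _); lia.
rewrite !block_unitS elem_mx_top top_mx_col !mul1mx mul0mx addr0.
rewrite !eqxx !block_unit_ge //.
have -> : (m == m.+1) = false by lia.
have -> : (m.+1 == m) = false by lia.
by rewrite !scalar_mx0 mulmx0 add0r.
Qed.

(** Such a matrix is either the leading one or the inverse of a matrix that fixes
this block column. *)
Lemma elem_mx_neg_fix m n h s (i : int) (P : 'M[K]_n) :
    (s <= h <= m)%N -> - m.+1%:Z <= i <= - h%:Z - 2 ->
  elem_mx m.+1 i P *m block_unit m.+1 n s = block_unit m.+1 n s.
Proof.
move=> sh im; have [j ei] : exists j : nat, i = - j%:Z by exists `|i|%N; lia.
subst i; have [e|ne] := eqVneq j m.+1.
  rewrite e elem_mx_lead block_unitS bdiag_col mul1mx.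
  have -> : (s == m)%N = false by lia.
  by rewrite scalar_mx0 mulmx0.
have [|E _] := @elem_mxN K m.+1 n j P; first by lia.
rewrite -{1}(@elem_mx_fix m n j s (- P)); [|lia..].
by rewrite mulmxA E mul1mx.
Qed.

Lemma elem_prod_cons m n i (P : 'M[K]_n) p Ps :
  elem_prod m (i :: p) (P :: Ps) = elem_mx m i P *m elem_prod m p Ps.
Proof. by rewrite /elem_prod big_cons. Qed.

Lemma elem_prod_nil m n Ps : elem_prod m [::] Ps = 1%:M :> 'M[K]_(m * n).
Proof. by case: Ps => *; rewrite /elem_prod big_nil. Qed.

Lemma elem_prod_cat m n p q (Ps Qs : seq 'M[K]_n) : size p = size Ps ->
  elem_prod m (p ++ q) (Ps ++ Qs) = elem_prod m p Ps *m elem_prod m q Qs.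
Proof.
elim: p Ps => [|i p IH] [|P Ps] //= => [_|[sz]].
  by rewrite elem_prod_nil mul1mx.
by rewrite !elem_prod_cons IH // mulmxA.
Qed.

(** Each factor either moves the unit block one step up or leaves it in place,
exactly as its index extends the staircase or not; the third possibility is ruled
out by [SIP_stair]. *)
Lemma elem_prod_block_unit m n t t0 (Ps : seq 'M[K]_n) :
    size Ps = size t -> {in t, forall i, 0 <= i <= m%:Z} ->
    SIP (t ++ t0) -> 0 \in t0 ->
  elem_prod m.+1 t Ps *m block_unit m.+1 n (stair t0).-1
  = block_unit m.+1 n (stair (t ++ t0)).-1.
Proof.
elim: t Ps => [|i t IH] [|P Ps] //= => [_ _ _ _|[sz] le_t sip t00].
  by rewrite elem_prod_nil mul1mx.
rewrite elem_prod_cons -mulmxA IH //; last first.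
- exact: SIP_behead sip.
- by move=> j jt; rewrite le_t // in_cons jt orbT.
have := SIP_stair sip; rewrite -/(stair _) /stair_step.
have: (0 < stair (t ++ t0))%N by rewrite stair_gt0 // mem_cat t00 orbT.
have: 0 <= i <= m%:Z by rewrite le_t ?mem_head.
case: (stair _) => //= c im _ /(_ isT) ne; case: eqP => [ei|ne'].
  by rewrite ei elem_mx_up //; lia.
have [j ei] : exists j : nat, i = j%:Z by exists `|i|%N; lia.
by rewrite ei elem_mx_fix //; lia.
Qed.

Lemma elem_prod_neg_fix m n h s t (Ps : seq 'M[K]_n) : size Ps = size t ->
    (s <= h <= m)%N -> {in t, forall i, - m.+1%:Z <= i <= - h%:Z - 2} ->
  elem_prod m.+1 t Ps *m block_unit m.+1 n s = block_unit m.+1 n s.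
Proof.
elim: t Ps => [|i t IH] [|P Ps] //= => [_ _ _|[sz] sh le_t].
  by rewrite elem_prod_nil mul1mx.
rewrite elem_prod_cons -mulmxA IH //.
  by rewrite (@elem_mx_neg_fix m n h) // le_t ?mem_head.
by move=> j jt; rewrite le_t // in_cons jt orbT.
Qed.

End BlockUnit.

Lemma map_block_unit (K K' : nzRingType) (f : {rmorphism K -> K'}) m n s :
  map_mx f (block_unit K m n s) = block_unit K' m n s.
Proof. by apply/matrixP => i j; rewrite !mxE rmorph_nat. Qed.

Section CommutativeProducts.
Variable K : comNzRingType.

Lemma tr_elem_prod m n p (Ps : seq 'M[K]_n) : size Ps = size p ->
  (elem_prod m p Ps)^T = elem_prod m (rev p) (rev (map trmx Ps)).
Proof.
elim: p Ps => [|i p IH] [|P Ps] //= => [_|[sz]]; first by rewrite !elem_prod_nil trmx1.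
rewrite elem_prod_cons trmx_mul IH // tr_elem_mx !rev_cons -!cats1.
rewrite elem_prod_cat ?size_rev ?size_map //.
by rewrite elem_prod_cons elem_prod_nil mulmx1.
Qed.

(** Transposition reverses products, and consecutions of a tuple are inversions of
the reversed one; hence the rows behave as the columns do. *)
Lemma block_unit_elem_prod m n t t0 (Ps : seq 'M[K]_n) :
    size Ps = size t -> {in t, forall i, 0 <= i <= m%:Z} ->
    SIP (t0 ++ t) -> 0 \in t0 ->
  (block_unit K m.+1 n (stair (rev t0)).-1)^T *m elem_prod m.+1 t Ps
  = (block_unit K m.+1 n (stair (rev (t0 ++ t))).-1)^T.
Proof.
move=> sz le_t sip t00; apply: trmx_inj.
rewrite trmx_mul !trmxK tr_elem_prod // rev_cat elem_prod_block_unit //.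
- by rewrite !size_rev size_map.
- by move=> i; rewrite mem_rev; apply: le_t.
- by rewrite -rev_cat; apply: SIP_rev.
- by rewrite mem_rev.
Qed.

Lemma neg_fix_elem_prod m n h s t (Ps : seq 'M[K]_n) : size Ps = size t ->
    (s <= h <= m)%N -> {in t, forall i, - m.+1%:Z <= i <= - h%:Z - 2} ->
  (block_unit K m.+1 n s)^T *m elem_prod m.+1 t Ps = (block_unit K m.+1 n s)^T.
Proof.
move=> sz sh le_t; apply: trmx_inj.
rewrite trmx_mul !trmxK tr_elem_prod // (@elem_prod_neg_fix _ m n h) //.
- by rewrite !size_rev size_map.
- by move=> i; rewrite mem_rev; apply: le_t.
Qed.

End CommutativeProducts.

(** * Equivalence that tracks two block vectors *)

Section Fiedler.
Variable K : comUnitRingType.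

(** L is equivalent to diag(P, I) by unimodular transformations that send u to the
first block column of the identity and v to the first block row: multiply by the
inverses of the frames [row_mx u S] and [col_mx v T].  Storing the frames and not
their inverses makes u and v visible and turns every transformation of L into a
product. *)
Definition reduces_to n c (L : 'M[K]_(n + c)) (u : 'M_(n + c, n)) (P : 'M_n)
    (v : 'M_(n, n + c)) : Prop :=
  exists S T, [/\ row_mx u S \in unitmx, col_mx v T \in unitmx &
                  L = S *m T + u *m P *m v].

Lemma reduces_toM n c (X Y L : 'M[K]_(n + c)) u P v :
    X \in unitmx -> Y \in unitmx -> reduces_to L u P v ->
  reduces_to (X *m L *m Y) (X *m u) P (v *m Y).
Proof.
move=> uX uY [S [T [uS vT ->]]]; exists (X *m S), (T *m Y); split.
- by rewrite -mul_mx_row unitmx_mul uX.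
- by rewrite -mul_col_mx unitmx_mul vT.
- by rewrite mulmxDr mulmxDl !mulmxA.
Qed.

Lemma reduces_to_tr n c (L : 'M[K]_(n + c)) u P v :
  reduces_to L u P v -> reduces_to L^T v^T P^T u^T.
Proof.
move=> [S [T [uS vT ->]]]; exists T^T, S^T; split.
- by rewrite -tr_col_mx unitmx_tr.
- by rewrite -tr_row_mx unitmx_tr.
- by rewrite linearD /= !trmx_mul mulmxA.
Qed.

Lemma unitmx_top_mx n c (P : 'M[K]_n) : top_mx c P 1%:M 1%:M 0 \in unitmx.
Proof.
have [] // := @mulmx1_unit _ _ (top_mx c P 1%:M 1%:M 0) (top_mx c 0 1%:M 1%:M (- P)).
by rewrite top_mxM !mulmx0 !mul0mx !mulmx1 !mul1mx !addr0 !add0r subrr top_mx1.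
Qed.

Lemma unitmx_bdiag a b (P : 'M[K]_a) (Q : 'M_b) :
  (bdiag P Q \in unitmx) = (P \in unitmx) && (Q \in unitmx).
Proof. by rewrite !unitmxE det_ublock unitrM. Qed.

(** Exchanging the first two block columns gives a block triangular matrix. *)
Lemma unitmx_frame n c (E : 'M[K]_n) (Y : 'M_(n + c, n)) u S :
    E \in unitmx -> row_mx u S \in unitmx ->
  row_mx (col_mx 0 u) (row_mx (col_mx E Y) (col_mx 0 S))
    \in @unitmx K (n + (n + c)).
Proof.
move=> uE uS.
suff: row_mx (col_mx 0 u) (row_mx (col_mx E Y) (col_mx 0 S))
        *m top_mx c 0 1%:M 1%:M 0 \in unitmx by rewrite unitmx_mul => /andP[].
have -> : row_mx (col_mx 0 u) (row_mx (col_mx E Y) (col_mx 0 S))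
    *m top_mx c 0 1%:M 1%:M 0 = block_mx E 0 Y (row_mx u S).
  rewrite /top_mx /bdiag !mul_row_block !mul_row_col mul_mx_row. 
  rewrite !mulmx0 !mulmx1 !addr0 !add0r add_row_mx addr0 add0r.
  rewrite block_mxEh; congr row_mx.
  by rewrite -block_mxEh block_mxEv row_mx0.
by rewrite unitmxE det_lblock unitrM -!unitmxE uE.
Qed.

(** Block elimination with the pivot -I: [Z + Y *m X] is its Schur complement. *)
Lemma reduces_to_step n c (X : 'M[K]_(n, n + c)) Y Z u P v :
    reduces_to (Z + Y *m X) u P v ->
  reduces_to (block_mx (- 1%:M) X Y Z) (col_mx 0 u) P (row_mx 0 v).
Proof.
have uN1 : - 1%:M \in @unitmx K n.
  by rewrite unitmxE -scaleN1r detZ det1 mulr1 unitrX ?unitrN1.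
move=> [S [T [uS vT eZ]]].
exists (row_mx (col_mx 1%:M (- Y)) (col_mx 0 S)),
       (col_mx (row_mx (- 1%:M) X) (row_mx 0 T)); split.
- by rewrite unitmx_frame ?unitmx1.
- rewrite -unitmx_tr !tr_col_mx !tr_row_mx !trmx0 unitmx_frame ?unitmx_tr //.
  by rewrite -tr_col_mx unitmx_tr.
rewrite mul_row_col !mul_col_row mulmx0 !mul0mx !add_block_mx !mul1mx !addr0.
rewrite mul_col_mx mul0mx mul_col_row !mulmx0 !mul0mx add_block_mx !addr0.
by rewrite mulmxN mulmx1 opprK mulNmx -addrA -eZ addrCA addNr addr0.
Qed.

End Fiedler.

(** * Fiedler pencils *)

Lemma elem_prod_coef_cons (K : nzRingType) m n (A : nat -> 'M[K]_n) i p :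
  elem_prod_coef m A (i :: p) = elem_mx m i (coef_at A i) *m elem_prod_coef m A p.
Proof. by rewrite /elem_prod_coef /= elem_prod_cons. Qed.

Lemma elem_prod_coef_cat (K : nzRingType) m n (A : nat -> 'M[K]_n) p q :
  elem_prod_coef m A (p ++ q) = elem_prod_coef m A p *m elem_prod_coef m A q.
Proof. by rewrite /elem_prod_coef map_cat elem_prod_cat ?size_map. Qed.

Lemma tr_elem_prod_coef (K : comNzRingType) m n (A : nat -> 'M[K]_n) p :
  (elem_prod_coef m A p)^T = elem_prod_coef m (fun i => (A i)^T) (rev p).
Proof.
rewrite /elem_prod_coef tr_elem_prod ?size_map // map_rev -map_comp.
congr (elem_prod _ _ (rev _)); apply: eq_map => i.
by rewrite /= /coef_at; case: ifP; rewrite ?linearN.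
Qed.

Lemma map_elem_prod_coef (K K' : nzRingType) (f : {rmorphism K -> K'}) m n
    (A : nat -> 'M[K]_n) p :
  map_mx f (elem_prod_coef m A p) = elem_prod_coef m (fun i => map_mx f (A i)) p.
Proof.
elim: p => [|i p IH]; first by rewrite /elem_prod_coef !elem_prod_nil map_mx1.
have coefE : map_mx f (coef_at A i) = coef_at (fun j => map_mx f (A j)) i.
  by rewrite /coef_at; case: ifP; rewrite ?map_mxN.
by rewrite !elem_prod_coef_cons map_mxM IH map_elem_mx coefE.
Qed.

Section FiedlerPencil.
Variable K : comUnitRingType.

Lemma elem_prod_coef_peel m n (A : nat -> 'M[K]_n) p :
    {in p, forall i, 0 <= i <= m%:Z} ->
  elem_prod_coef m.+2 A p = bdiag 1%:M (elem_prod_coef m.+1 A p).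
Proof.
elim: p => [|i p IH] le_p; first by rewrite /elem_prod_coef !elem_prod_nil bdiag1.
rewrite !elem_prod_coef_cons IH => [|j jp]; last by rewrite le_p // in_cons jp orbT.
have [] : exists2 j : nat, (j <= m)%N & i = j%:Z.
  by have := le_p i (mem_head _ _); exists `|i|%N; lia.
by move=> j jm ->; rewrite elem_mx_peel // bdiagM mulmx1.
Qed.

Lemma elem_mx_top_comm m n (j : nat) (P Q : 'M[K]_n) : (j < m)%N ->
  elem_mx m.+2 j P *m elem_mx m.+2 m.+1 Q = elem_mx m.+2 m.+1 Q *m elem_mx m.+2 j P.
Proof.
case: m => // m jm; rewrite elem_mx_top !elem_mx_peel ?(ltnW jm) //.
move: (elem_mx _ _ _) => X; rewrite /top_mx /bdiag !mulmx_block.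
rewrite !mul_mx_row !mul_row_block !mul_block_col !mul_col_mx.
by rewrite !(mul1mx, mulmx1, mul0mx, mulmx0, row_mx0, col_mx0, addr0, add0r).
Qed.

Lemma elem_prod_coef_top_comm m n (A : nat -> 'M[K]_n) p Q :
    {in p, forall i, 0 <= i < m%:Z} ->
  elem_prod_coef m.+2 A p *m elem_mx m.+2 m.+1 Q
  = elem_mx m.+2 m.+1 Q *m elem_prod_coef m.+2 A p.
Proof.
elim: p => [|i p IH] lt_p.
  by rewrite /elem_prod_coef !elem_prod_nil mul1mx mulmx1.
have [] : exists2 j : nat, (j < m)%N & i = j%:Z.
  by have := lt_p i (mem_head _ _); exists `|i|%N; lia.
move=> j jm ei; rewrite !elem_prod_coef_cons -mulmxA IH; last first.
  by move=> k kp; rewrite lt_p // in_cons kp orbT.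
by rewrite ei !mulmxA elem_mx_top_comm.
Qed.

(** [lam] is any ring element, and the coefficients may involve it: the induction
needs this. *)
Definition fiedler_pencil m n (lam : K) (A : nat -> 'M[K]_n) (p : seq int) :=
  lam *: elem_mx m (- m%:Z) (A m) - elem_prod_coef m A p.

Definition reduces_fiedler m n lam (A : nat -> 'M[K]_n) p :=
  reduces_to (fiedler_pencil m.+1 lam A p : 'M_(n + m * n))
    (block_unit K m.+1 n (stair p).-1) (\sum_(j < m.+2) lam ^+ j *: A j)
    (block_unit K m.+1 n (stair (rev p)).-1)^T.

Lemma tr_fiedler_pencil m n lam (A : nat -> 'M[K]_n) p :
  (fiedler_pencil m lam A p)^T = fiedler_pencil m lam (fun j => (A j)^T) (rev p).
Proof.
by rewrite /fiedler_pencil linearB linearZ /= tr_elem_mx tr_elem_prod_coef.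
Qed.

Lemma reduces_fiedler_tr m n lam (A : nat -> 'M[K]_n) p :
  reduces_fiedler m lam (fun j => (A j)^T) (rev p) -> reduces_fiedler m lam A p.
Proof.
rewrite /reduces_fiedler -tr_fiedler_pencil => /reduces_to_tr.
rewrite !trmxK revK linear_sum /=.
by under eq_bigr => j _ do rewrite linearZ /= trmxK.
Qed.

(** Dividing by the factor of largest index puts the pivot -I in the first block and
leaves the leading coefficient only in the second row. *)
Lemma fiedler_pencil_step m n lam (A : nat -> 'M[K]_n) p :
    {in p, forall i, 0 <= i <= m%:Z} ->
  fiedler_pencil m.+2 lam A (m.+1%:Z :: p) =
  elem_mx m.+2 m.+1 (- A m.+1) *m
  block_mx (- 1%:M) (row_mx lam%:M 0) (col_mx (lam *: A m.+2) 0)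
           (lam *: bdiag (A m.+1) 1%:M - elem_prod_coef m.+1 A p).
Proof.
move=> le_p; rewrite /fiedler_pencil elem_prod_coef_cons elem_prod_coef_peel //.
rewrite /coef_at /= elem_mx_lead elem_mx_top.
have -> : bdiag (A m.+2) 1%:M = top_mx (m * n) (- A m.+1) 1%:M 1%:M 0 *m
   top_mx (m * n) 0 1%:M (A m.+2) (A m.+1).
  rewrite top_mxM !mulmx0 !mul0mx !mulmx1 !mul1mx !addr0 !add0r addNr.
  by rewrite /top_mx row_mx0 col_mx0 bdiag1.
rewrite scalemxAr -mulmxBr; congr (_ *m _).
rewrite /top_mx /bdiag scale_block_mx opp_block_mx add_block_mx.
by rewrite !scaler0 !oppr0 !addr0 add0r scale_row_mx scale_col_mx !scaler0 scalemx1.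
Qed.

(** If m is not on the left of m + 1, then M_(m+1) commutes with all that precedes
it and can be moved to the front; the Schur complement after division by it is the
Fiedler pencil of the next smaller size, with the last two coefficients merged. *)
Lemma reduces_fiedler_step m n lam (A : nat -> 'M[K]_n) a b :
    (forall A' p, perm_eq p (nat_range 0 m.+1) -> reduces_fiedler m lam (A' : nat -> 'M_n) p) ->
    perm_eq (a ++ m.+1%:Z :: b) (nat_range 0 m.+2) -> m%:Z \notin a ->
  reduces_fiedler m.+1 lam A (a ++ m.+1%:Z :: b).
Proof.
move=> IH perm_ab m_a.
have {perm_ab} perm_p : perm_eq (a ++ b) (nat_range 0 m.+1).
  move: perm_ab; rewrite -cat1s perm_catCA cat1s /nat_range -[m.+2]addn1 iotaD.
  by rewrite map_cat cats1 perm_sym perm_rcons perm_cons perm_sym.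
have p_lt : {in a ++ b, forall i, 0 <= i < m.+1%:Z}.
  by move=> i; rewrite (perm_mem perm_p) mem_nat_range.
have a_lt : {in a, forall i, 0 <= i < m%:Z}.
  move=> i ia; have := p_lt i; rewrite mem_cat ia => /(_ isT).
  suff: i != m%:Z by lia.
  by apply: contraNneq m_a => <-.
have zero_p : 0 \in a ++ b by rewrite (perm_mem perm_p) mem_nat_range.
have uniq_p : uniq (a ++ b) by rewrite (perm_uniq perm_p) uniq_nat_range.
have p_le : {in a ++ b, forall i, 0 <= i <= m%:Z} by move=> i /p_lt; lia.
(* A' has the same value at lam as A, with one coefficient less *)
pose A' j := if j == m.+1 then A m.+1 + lam *: A m.+2 else A j.
have eqA : fiedler_pencil m.+2 lam A (a ++ m.+1%:Z :: b)
         = fiedler_pencil m.+2 lam A (m.+1%:Z :: a ++ b).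
  rewrite /fiedler_pencil !elem_prod_coef_cat !elem_prod_coef_cons.
  by rewrite elem_prod_coef_cat !mulmxA elem_prod_coef_top_comm.
have eq_sum : \sum_(j < m.+3) lam ^+ j *: A j = \sum_(j < m.+2) lam ^+ j *: A' j.
  rewrite big_ord_recr [X in X + _ = _]big_ord_recr [RHS]big_ord_recr /=.
  rewrite /A' eqxx scalerDr scalerA -exprSr addrA; congr (_ + _ + _).
  by apply: eq_bigr => j _; rewrite ltn_eqF.
have eq_stair : stair (a ++ m.+1%:Z :: b) = stair (m.+1%:Z :: a ++ b).
  by apply: stair_shift => // i /a_lt; lia.
have eq_stair_rev : stair (rev (a ++ m.+1%:Z :: b)) = stair (rev (a ++ b)).
  rewrite !rev_cat rev_cons cat_rcons stair_drop // => i.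
  by rewrite mem_rev => /a_lt; lia.
have := IH A' _ perm_p; rewrite /reduces_fiedler eqA eq_sum eq_stair eq_stair_rev.
rewrite fiedler_pencil_step //.
have -> : fiedler_pencil m.+1 lam A' (a ++ b) =
    lam *: bdiag (A m.+1) 1%:M - elem_prod_coef m.+1 A (a ++ b)
    + col_mx (lam *: A m.+2) 0 *m row_mx lam%:M 0.
  rewrite /fiedler_pencil elem_mx_lead /A' eqxx addrAC; congr (_ - _).
    rewrite mul_col_row !mul0mx mulmx0 /bdiag !scale_block_mx add_block_mx.
    by rewrite mul_mx_scalar scalerDr !addr0.
  rewrite /elem_prod_coef; congr elem_prod; apply/eq_in_map => i /p_lt.
  by rewrite /coef_at => ilt; rewrite ltn_eqF //; lia.
move/reduces_to_step => /(reduces_toM (unitmx_top_mx (m * n) (- A m.+1)) (unitmx1 _ _)).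
(* the staircase stops before the top block, so the new block of u and v is 0 *)
have low q : {in q, forall i, 0 <= i < m.+1%:Z} ->
    block_unit K m.+2 n (stair q).-1 = col_mx 0 (block_unit K m.+1 n (stair q).-1).
  move=> lt_q; have le_q : (stair q <= m.+1)%N by apply: stair_le => i /lt_q; lia.
  by rewrite [LHS]block_unitS ltn_eqF ?scalar_mx0 //; lia.
have eq_u : elem_mx m.+2 m.+1 (- A m.+1) *m block_unit K m.+2 n (stair (a ++ b)).-1
          = block_unit K m.+2 n (stair (m.+1%:Z :: a ++ b)).-1.
  have := @elem_prod_block_unit K m.+1 n [:: m.+1%:Z] (a ++ b) [:: - A m.+1].
  rewrite elem_prod_cons elem_prod_nil mulmx1; apply=> //.
    by move=> i; rewrite inE => /eqP->; lia.
  by apply: uniq_SIP; rewrite /= uniq_p andbT; apply/negP => /p_lt; lia.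
rewrite -eq_u !low ?elem_mx_top //; last by move=> i; rewrite mem_rev => /p_lt.
by rewrite !mulmx1 tr_col_mx trmx0.
Qed.

Lemma fiedler_reduces m n lam (A : nat -> 'M[K]_n) p :
  perm_eq p (nat_range 0 m.+1) -> reduces_fiedler m lam A p.
Proof.
elim: m A p => [|m IH] A p perm_p.
  have -> : p = [:: 0] by apply: perm_small_eq.
  rewrite /reduces_fiedler.
  have -> : block_unit K 1 n (stair [:: 0]).-1 = col_mx 1%:M (0 : 'M_(0 * n, n)).
    by rewrite block_unitS [X in col_mx _ X]block_unit_ge.
  rewrite tr_col_mx trmx1 trmx0; exists (col_mx 0 1%:M), (row_mx 0 1%:M); split.
  - by rewrite -block_mxEh -scalar_mx_block unitmx1.
  - by rewrite -block_mxEv -scalar_mx_block unitmx1.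
  rewrite /fiedler_pencil elem_prod_coef_cons /elem_prod_coef elem_prod_nil mulmx1.
  rewrite elem_mx_lead elem_mx_last !big_ord_recl big_ord0 /=.
  rewrite !mul_col_mx !mul_mx_row !(mul0mx, mulmx0, mul1mx, mulmx1, addr0).
  rewrite -!block_mxEv add_block_mx !addr0 !add0r /bdiag scale_block_mx.
  rewrite opp_block_mx add_block_mx !scaler0 !oppr0 !addr0 /coef_at /= opprK.
  rewrite expr0 scale1r expr1 addrC; congr block_mx.
  by apply/matrixP => -[].
have mp : m.+1%:Z \in p by rewrite (perm_mem perm_p) mem_nat_range; lia.
have uniq_p : uniq p by rewrite (perm_uniq perm_p) uniq_nat_range.
move: perm_p uniq_p; have [a b] := splitPr mp => perm_p uniq_p.
have [m_a|] := boolP (m%:Z \in a); last exact: reduces_fiedler_step.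
have m_b : m%:Z \notin b.
  apply/negP => m_b; move: uniq_p; rewrite cat_uniq => /and3P[_ /hasPn /(_ m%:Z)].
  by rewrite inE m_b orbT m_a => /(_ isT).
(* here m is on the left of m + 1: transposing exchanges the two sides *)
apply: reduces_fiedler_tr.
rewrite rev_cat rev_cons cat_rcons; apply: reduces_fiedler_step => //.
  by rewrite -cat_rcons -rev_cons -rev_cat perm_rev.
by rewrite mem_rev.
Qed.

End FiedlerPencil.

(** * Generalized Fiedler pencils with repetition *)

Section Invertibility.
Variable K : comUnitRingType.

Lemma unitmx_elem_mx m n (i : int) (P : 'M[K]_n) :
    - m.+1%:Z <= i <= m%:Z -> (i \in [:: 0; - m.+1%:Z] -> P \in unitmx) ->
  elem_mx m.+1 i P \in unitmx.
Proof.
move=> im uP; have [e|ne] := eqVneq i (- m.+1%:Z).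
  rewrite e in uP *; rewrite elem_mx_lead unitmx_bdiag unitmx1 uP //.
  by rewrite !inE eqxx orbT.
have [e|ne0] := eqVneq i 0.
  rewrite e in uP *; have {}uP : P \in unitmx by rewrite uP ?inE ?eqxx.
  elim: (m) => [|m' IH]; first by rewrite elem_mx_last unitmx_bdiag uP unitmx1.
  by rewrite elem_mx_peel // unitmx_bdiag unitmx1.
have jm : (0 < `|i| < m.+1)%N by lia.
have [i0|i0] := lerP 0 i.
  have [_] := elem_mxN (- P) jm; rewrite opprK gez0_abs //.
  by case/mulmx1_unit.
by have [] := elem_mxN P jm; rewrite ltz0_abs // opprK => /mulmx1_unit[].
Qed.

(** The factors of -i and i cancel in pairs, starting from the middle. *)
Lemma elem_prod_coef_opp m n (A : nat -> 'M[K]_n) t :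
    {in t, forall i, - m%:Z <= i < 0} ->
  elem_prod_coef m.+1 A t *m elem_prod_coef m.+1 A (rev [seq - i | i <- t]) = 1%:M.
Proof.
elim: t => [|i t IH] lt_t.
  by rewrite /elem_prod_coef !elem_prod_nil mulmx1.
have [] : exists2 j : nat, (0 < j < m.+1)%N & i = - j%:Z.
  by have := lt_t i (mem_head _ _); exists `|i|%N; lia.
move=> j jm ei; have [inv _] := elem_mxN (A j) jm.
rewrite /= rev_cons -cats1 elem_prod_coef_cat !elem_prod_coef_cons.
rewrite -mulmxA (mulmxA (elem_prod_coef _ _ t)) IH; last first.
  by move=> x xt; apply: lt_t; rewrite in_cons xt orbT.
rewrite mul1mx /elem_prod_coef elem_prod_nil mulmx1 ei opprK.
have -> : coef_at A (- j%:Z) = A j.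
  by rewrite /coef_at ifF ?abszN //; lia.
by [].
Qed.

Lemma unitmx_flip a n N (e : (a + n = N)%N) (u : 'M[K]_(N, n)) (S : 'M_(N, a)) x y :
  u *m x + S *m y = 1%:M -> castmx (erefl N, e) (row_mx S u) \in unitmx.
Proof.
case: N / e u S x y => u S x y uS; rewrite castmx_id.
have [] // := @mulmx1_unit _ _ (row_mx S u) (col_mx y x).
by rewrite mul_row_col addrC.
Qed.

End Invertibility.

Lemma unitmx_elem_prod (F : fieldType) m n p (Ps : seq 'M[F]_n) :
    size Ps = size p -> {in p, forall i, - m.+1%:Z <= i <= m%:Z} ->
    nonsingular_assignment m.+1 p Ps ->
  elem_prod m.+1 p Ps \in unitmx.
Proof.
elim: p Ps => [|i p IH] [|P Ps] //= => [_ _ _|[sz] le_p ns].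
  by rewrite elem_prod_nil unitmx1.
rewrite elem_prod_cons unitmx_mul unitmx_elem_mx ?IH //.
- by move=> j jp; apply: le_p; rewrite in_cons jp orbT.
- by move=> a; apply: (ns a.+1).
- by apply: le_p; rewrite mem_head.
- by apply: (ns 0%N).
Qed.

Lemma unitmx_map_polyC (F : fieldType) n (M : 'M[F]_n) :
  M \in unitmx -> map_mx polyC M \in unitmx.
Proof. by rewrite !unitmxE det_map_mx => /(rmorph_unit polyC). Qed.

Lemma map_elem_prod (K K' : nzRingType) (f : {rmorphism K -> K'}) m n p
    (Ps : seq 'M[K]_n) :
  map_mx f (elem_prod m p Ps) = elem_prod m p (map (map_mx f) Ps).
Proof.
elim: p Ps => [|i p IH] [|P Ps]; rewrite ?elem_prod_nil ?map_mx1 //=.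
  by rewrite /elem_prod !big_nil map_mx1.
by rewrite !elem_prod_cons map_mxM IH map_elem_mx.
Qed.

Section GFPRReduction.
Variables (F : fieldType) (m n h : nat) (A : nat -> 'M[F]_n).
Variables (s t s1 s2 t1 t2 : seq int) (x1 x2 y1 y2 : seq 'M[F]_n).
Hypothesis data : gfpr_data m.+1 h s t s1 s2 t1 t2 x1 x2 y1 y2.

Lemma gfpr_mem_s i : (i \in s) = (0 <= i <= h%:Z).
Proof.
by rewrite (perm_mem (gfpr_s data)) -/(nat_range 0 h.+1) mem_nat_range; lia.
Qed.

Lemma gfpr_mem_t i : (i \in t) = (- m.+1%:Z <= i <= - h%:Z - 1).
Proof.
have hm := gfpr_h data; rewrite (perm_mem (gfpr_t data)).
apply/mapP/idP => [[j]|im]; first by rewrite mem_iota => jm ->; lia.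
by exists `|i|%N; rewrite ?mem_iota; lia.
Qed.

Lemma gfpr_inversions0 : (inversions0 (s1 ++ s) <= h)%N.
Proof.
rewrite inversions0_stair; suff: (stair (s1 ++ s) <= h.+1)%N by lia.
apply: stair_le => i; rewrite mem_cat gfpr_mem_s => /orP[/(gfpr_s1 data)|]; lia.
Qed.

Lemma gfpr_consecutions0 : (consecutions0 (s ++ s2) <= h)%N.
Proof.
rewrite consecutions0_rev inversions0_stair.
suff: (stair (rev (s ++ s2)) <= h.+1)%N by lia.
apply: stair_le => i; rewrite mem_rev mem_cat gfpr_mem_s.
by move=> /orP[|/(gfpr_s2 data)]; lia.
Qed.

Hypotheses (nx1 : nonsingular_assignment m.+1 s1 x1)
  (nx2 : nonsingular_assignment m.+1 s2 x2)
  (ny1 : nonsingular_assignment m.+1 t1 y1)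
  (ny2 : nonsingular_assignment m.+1 t2 y2).

(** Removing the invertible constant factors on both sides leaves a Fiedler pencil.
Each factor that is removed changes i0 or c0 of the remaining tuple in the same
way as it changes the unit block vector on which it acts. *)
Lemma gfpr_reduces :
  reduces_to
    (gfpr_diag m.+1 A s t s1 s2 t1 t2 x1 x2 y1 y2 : 'M_(n + m * n))
    (block_unit {poly F} m.+1 n (inversions0 (s1 ++ s)))
    (matpoly m.+1 A)
    (block_unit {poly F} m.+1 n (consecutions0 (s ++ s2)))^T.
Proof.
have hm := gfpr_h data.
have zs : 0 \in s by rewrite gfpr_mem_s.
have mt : - m.+1%:Z \in t by rewrite gfpr_mem_t; lia.
have t_neg := gfpr_mem_t; have := gfpr_t data.
rewrite /gfpr_diag; move: t_neg; have [a b] := splitPr mt => t_neg perm_t.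
have uniq_t : uniq (a ++ - m.+1%:Z :: b).
  rewrite (perm_uniq perm_t) map_inj_uniq ?iota_uniq // => x y; lia.
have ab_lt : {in a ++ b, forall i, - m%:Z <= i < - h%:Z}.
  move=> i iab; have := t_neg i; rewrite -cat1s mem_cat (mem_cat _ [:: _]) orbCA -mem_cat iab orbT.
  have : i != - m.+1%:Z.
    apply: contraTneq uniq_t => <-.
    by rewrite -cat1s uniq_catCA /= iab.
  lia.
pose A' j := map_mx polyC (A j).
pose na := rev [seq - i | i <- a]; pose nb := rev [seq - i | i <- b].
pose rho := na ++ s ++ nb.
have na_ge : {in na, forall i, h%:Z < i <= m%:Z}.
  move=> i; rewrite mem_rev => /mapP[j ja ->].
  by have := ab_lt j; rewrite mem_cat ja => /(_ isT); lia.
have nb_ge : {in nb, forall i, h%:Z < i <= m%:Z}.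
  move=> i; rewrite mem_rev => /mapP[j jb ->].
  by have := ab_lt j; rewrite mem_cat jb orbT => /(_ isT); lia.
(* the extreme index of tau occurs once; all others return in rho with
   opposite sign *)
have perm_rho : perm_eq rho (nat_range 0 m.+1).
  rewrite -(perm_cons m.+1%:Z).
  have : perm_eq (s ++ [seq - i | i <- a ++ - m.+1%:Z :: b]) (m.+1%:Z :: nat_range 0 m.+1).
    apply: (@perm_trans _ (nat_range 0 m.+2)); last first.
      rewrite /nat_range -[m.+2]addn1 iotaD map_cat cats1 perm_rcons.
      by rewrite perm_cons.
    have -> : nat_range 0 m.+2 = nat_range 0 h.+1 ++ nat_range h.+1 (m.+1 - h).
      by rewrite /nat_range -map_cat -iotaD; congr (map _ (iota _ _)); lia.
    apply: perm_cat (gfpr_s data) _.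
    have := perm_map -%R perm_t; rewrite -map_comp (@eq_map _ _ _ Posz) // => j.
    by rewrite /= opprK.
  move=> perm_st; apply: perm_trans perm_st; apply/permP => q.
  rewrite /rho /na /nb map_cat /= opprK !count_cat /= !count_rev.
  lia.
have uniq_rho : uniq rho by rewrite (perm_uniq perm_rho) uniq_nat_range.
have ea : elem_prod_coef m.+1 A' a *m elem_prod_coef m.+1 A' na = 1%:M.
  apply: elem_prod_coef_opp => i ia.
  by have := ab_lt i; rewrite mem_cat ia => /(_ isT); lia.
have eb : elem_prod_coef m.+1 A' nb *m elem_prod_coef m.+1 A' b = 1%:M.
  apply: mulmx1C; apply: elem_prod_coef_opp => i ib.
  by have := ab_lt i; rewrite mem_cat ib orbT => /(_ isT); lia.
have := fiedler_reduces 'X A' perm_rho; rewrite /reduces_fiedler.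
pose G1 := elem_prod m.+1 (t1 ++ s1) (map (map_mx polyC) (y1 ++ x1)).
pose G2 := elem_prod m.+1 (s2 ++ t2) (map (map_mx polyC) (x2 ++ y2)).
have uG1 : G1 \in unitmx.
  rewrite /G1 /G2 -map_elem_prod unitmx_map_polyC // elem_prod_cat ?(gfpr_y1 data) //.
  rewrite unitmx_mul !unitmx_elem_prod //.
  - exact: gfpr_x1 data.
  - by move=> i /(gfpr_s1 data); lia.
  - exact: gfpr_y1 data.
  - by move=> i /(gfpr_t1 data); lia.
have uG2 : G2 \in unitmx.
  rewrite /G1 /G2 -map_elem_prod unitmx_map_polyC // elem_prod_cat ?(gfpr_x2 data) //.
  rewrite unitmx_mul !unitmx_elem_prod //.
  - exact: gfpr_y2 data.
  - by move=> i /(gfpr_t2 data); lia.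
  - exact: gfpr_x2 data.
  - by move=> i /(gfpr_s2 data); lia.
have [ua _] := mulmx1_unit ea; have [_ ub] := mulmx1_unit eb.
have uX : G1 *m elem_prod_coef m.+1 A' a \in unitmx by rewrite unitmx_mul uG1.
have uY : elem_prod_coef m.+1 A' b *m G2 \in unitmx by rewrite unitmx_mul ub.
move/(reduces_toM uX uY); congr reduces_to.
- rewrite /gfpr_diag !map_elem_prod_coef !map_elem_prod -/G1 -/G2 -/A'.
  rewrite -!mulmxA; congr (G1 *m _); rewrite !mulmxA; congr (_ *m G2).
  rewrite /fiedler_pencil mulmxBr mulmxBl -scalemxAr -scalemxAl.
  rewrite /rho !elem_prod_coef_cat elem_prod_coef_cons !mulmxA ea mul1mx.
  rewrite -(mulmxA (elem_prod_coef _ _ s)) eb mulmx1.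
  by have -> : coef_at A' (- m.+1%:Z) = A' m.+1 by [].
- rewrite -mulmxA.
  have -> : stair rho = stair (na ++ s).
    by rewrite /rho catA stair_catr //; apply/negP => /nb_ge.
  have <- : elem_prod_coef m.+1 A' na *m block_unit {poly F} m.+1 n (stair s).-1
      = block_unit {poly F} m.+1 n (stair (na ++ s)).-1.
    apply: elem_prod_block_unit; rewrite ?size_map //.
      by move=> i /na_ge /andP[hi ->]; rewrite andbT ltW // (le_lt_trans _ hi).
    by apply: (@SIP_catl _ nb); rewrite -catA; apply: uniq_SIP.
  rewrite (mulmxA (elem_prod_coef _ _ a)) ea mul1mx.
  rewrite /G1 map_cat elem_prod_cat ?size_map ?(gfpr_y1 data) // -mulmxA.
  rewrite inversions0_stair elem_prod_block_unit ?size_map ?(gfpr_x1 data) //.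
  + rewrite -inversions0_stair (@elem_prod_neg_fix _ m n h) //.
    * by rewrite size_map (gfpr_y1 data).
    * by rewrite gfpr_inversions0 -ltnS.
    * exact: gfpr_t1 data.
  + by move=> i /(gfpr_s1 data); clear -hm; lia.
  + by apply: (@SIP_catl _ s2); rewrite -catA; apply: gfpr_sip_s data.
- rewrite mulmxA.
  have -> : stair (rev rho) = stair (rev (s ++ nb)).
    by rewrite /rho rev_cat stair_catr // mem_rev; apply/negP => /na_ge.
  have <- : (block_unit {poly F} m.+1 n (stair (rev s)).-1)^T *m elem_prod_coef m.+1 A' nb
      = (block_unit {poly F} m.+1 n (stair (rev (s ++ nb))).-1)^T.
    apply: block_unit_elem_prod; rewrite ?size_map //.
      by move=> i /nb_ge /andP[hi ->]; rewrite andbT ltW // (le_lt_trans _ hi).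
    by apply/uniq_SIP; move: uniq_rho; rewrite cat_uniq => /and3P[].
  have cancel_b (Z : 'M_(n, m.+1 * n)) :
      Z *m elem_prod_coef m.+1 A' nb *m elem_prod_coef m.+1 A' b = Z.
    by rewrite -mulmxA eb mulmx1.
  rewrite cancel_b.
  rewrite /G2 map_cat elem_prod_cat ?size_map ?(gfpr_x2 data) // mulmxA.
  rewrite consecutions0_rev inversions0_stair.
  rewrite block_unit_elem_prod ?size_map ?(gfpr_x2 data) //.
  + rewrite -inversions0_stair -consecutions0_rev (@neg_fix_elem_prod _ m n h) //.
    * by rewrite size_map (gfpr_y2 data).
    * by rewrite gfpr_consecutions0 -ltnS.
    * exact: gfpr_t2 data.
  + by move=> i /(gfpr_s2 data); clear -hm; lia.
  + exact: SIP_catr (gfpr_sip_s data).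
Qed.
End GFPRReduction.

(** * Assembling the two diagonal blocks *)

Section Assembly.
Variable K : comUnitRingType.

(** Both sides have the same blocks, in sums of sizes that are associated
differently. *)
Lemma conform_target a n r b (PA : 'M[K]_n) (X : 'M_(n, r)) (Y : 'M_(r, n)) (PD : 'M_r) :
  conform_mx 0 (bdiag (1%:M : 'M_a) (bdiag (block_mx PA X Y PD) (1%:M : 'M_b)))
  = block_mx (bdiag 1%:M PA) (block_mx 0 0 X 0) (block_mx 0 Y 0 0)
      (bdiag PD 1%:M) :> 'M_((a + n) + (r + b)).
Proof.
have e : (a + ((n + r) + b) = (a + n) + (r + b))%N by rewrite !addnA.
rewrite (conform_castE e) /bdiag; apply/matrixP => i j; rewrite castmxE /=.
pose f : 'I_((a + n) + (r + b)) -> 'I_(a + ((n + r) + b)) := cast_ord (esym e).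
rewrite -/(f i) -/(f j).
have f1 x : f (lshift _ (lshift _ x)) = lshift _ x by apply: val_inj.
have f2 x : f (lshift _ (rshift _ x)) = rshift _ (lshift _ (lshift _ x)).
  exact: val_inj.
have f3 x : f (rshift _ (lshift _ x)) = rshift _ (lshift _ (rshift _ x)).
  by apply: val_inj; rewrite /= addnA.
have f4 x : f (rshift _ (rshift _ x)) = rshift _ (rshift _ x).
  by apply: val_inj; rewrite /= !addnA.
have fE := (f1, f2, f3, f4).
by case: (split_ordP i) => i' ->; case: (split_ordP i') => i'' ->;
   case: (split_ordP j) => j' ->; case: (split_ordP j') => j'' ->;
   rewrite !fE; do ?rewrite (block_mxEul, block_mxEur, block_mxEdl, block_mxEdr);
   rewrite ?mxE.
Qed.

(** The frame of D has its distinguished block first, that of A last, because in the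
target the blocks P_A and P_D are adjacent.  With the inverse frames as
transformations, the off-diagonal blocks reduce to X and Y. *)
Lemma assemble a n N r b (eN : (a + n = N)%N)
    (uA : 'M[K]_(N, n)) SA PA vA TA (uD : 'M_(r + b, r)) SD PD vD TD
    (X : 'M_(n, r)) (Y : 'M_(r, n)) :
    castmx (erefl N, eN) (row_mx SA uA) \in unitmx ->
    castmx (eN, erefl N) (col_mx TA vA) \in unitmx ->
    row_mx uD SD \in unitmx -> col_mx vD TD \in unitmx ->
  exists (UA VA : 'M_N) (UD VD : 'M_(r + b)),
    [/\ UA \in unitmx, VA \in unitmx, UD \in unitmx, VD \in unitmx &
      bdiag UA UD
      *m block_mx (SA *m TA + uA *m PA *m vA) (uA *m X *m vD)
                  (uD *m Y *m vA) (SD *m TD + uD *m PD *m vD)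
      *m bdiag VA VD
      = conform_mx 0
          (bdiag (1%:M : 'M_a) (bdiag (block_mx PA X Y PD) (1%:M : 'M_b)))].
Proof.
case: N / eN uA SA vA TA => uA SA vA TA; rewrite !castmx_id => hA hA' hD hD'.
exists (invmx (row_mx SA uA)), (invmx (col_mx TA vA)),
       (invmx (row_mx uD SD)), (invmx (col_mx vD TD)).
split; rewrite ?unitmx_inv // conform_target.
have -> : block_mx (SA *m TA + uA *m PA *m vA) (uA *m X *m vD)
                  (uD *m Y *m vA) (SD *m TD + uD *m PD *m vD)
  = bdiag (row_mx SA uA) (row_mx uD SD)
    *m block_mx (bdiag 1%:M PA) (block_mx 0 0 X 0) (block_mx 0 Y 0 0)
      (bdiag PD 1%:M)
    *m bdiag (col_mx TA vA) (col_mx vD TD).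
  rewrite {1 4}/bdiag !mulmx_block !mul0mx !mulmx0 !addr0 !add0r /bdiag.
  rewrite !mul_row_block !mulmx0 !mulmx1 !addr0 !add0r !mul_row_col !mul0mx.
  by rewrite ?addr0 ?add0r [_ + SD *m TD]addrC.
by rewrite !mulmxA bdiagM !mulVmx // bdiag1 mul1mx -mulmxA bdiagM !mulmxV // bdiag1 mulmx1.
Qed.

Lemma unitmx_row_swap a n (e : (a + n = n + a)%N) (u : 'M[K]_(n + a, n)) S :
  row_mx u S \in unitmx -> castmx (erefl _, e) (row_mx S u) \in unitmx.
Proof.
move=> uS; set W := invmx (row_mx u S).
apply: (@unitmx_flip _ _ _ _ e u S (usubmx W) (dsubmx W)).
by rewrite -mul_row_col vsubmxK mulmxV.
Qed.

Lemma unitmx_col_swap a n (e : (a + n = n + a)%N) (v : 'M[K]_(n, n + a)) T :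
  col_mx v T \in unitmx -> castmx (e, erefl _) (col_mx T v) \in unitmx.
Proof.
rewrite -unitmx_tr tr_col_mx => /(unitmx_row_swap e).
by rewrite -unitmx_tr trmx_cast /= tr_row_mx !trmxK.
Qed.

End Assembly.

Section Tensor.
Variable F : comNzRingType.

Lemma block_unit_mulmx m n q s (X : 'M[F]_(n, q)) i j :
  (block_unit F m n s *m X) i j
  = ((mxtens_unindex i).1 + s.+1 == m)%N%:R * X (mxtens_unindex i).2 j.
Proof.
rewrite mxE (bigD1 (mxtens_unindex i).2) //= big1 => [|l ne].
  by rewrite mxE /= eqxx andbT addr0.
rewrite mxE (_ : (i %% n == l)%N = false) ?andbF ?mul0r //.
by apply: contraNF ne => /eqP e; apply/eqP/val_inj.
Qed.

(** The Kronecker product with the rank one matrix e_(m-s) e_(k-c)^T places X in one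
block. *)
Lemma tens_block_unit m n k r s c (X : 'M[F]_(n, r)) : (s < m)%N -> (c < k)%N ->
  (std_col F m (m - s) *m (std_col F k (k - c))^T) *t X
  = block_unit F m n s *m X *m (block_unit F k r c)^T.
Proof.
move=> sm ck; apply/matrixP => i j.
rewrite -mulmxA block_unit_mulmx -[X *m _]trmxK trmx_mul trmxK mxE.
rewrite [in RHS]mxE block_unit_mulmx !mxE big_ord1 !mxE /=.
rewrite -mulrA mulrCA mulrA [_ * _%:R]mulrC.
have eq1 x a b : (b < a)%N -> (x.+1 == a - b)%N = (x + b.+1 == a)%N by lia.
by rewrite !eq1 // mulrA.
Qed.

End Tensor.

Lemma gfpr_is_pencil (F : fieldType) m n (A : nat -> 'M[F]_n)
    s t s1 s2 t1 t2 x1 x2 y1 y2 :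
  is_pencil (gfpr_diag m A s t s1 s2 t1 t2 x1 x2 y1 y2).
Proof.
move=> i j; rewrite /gfpr_diag mulmxBr mulmxBl -scalemxAr -scalemxAl -!map_mxM.
move: (_ *m _ *m _) (_ *m _ *m _) => X Y; rewrite !mxE mulrC mul_polyC.
rewrite (leq_trans (size_polyD _ _)) // geq_max size_polyN.
rewrite (leq_trans (size_scale_leq _ _)) ?size_polyX //.
by rewrite (leq_trans (size_polyC_leq1 _)).
Qed.

Theorem theorem2p18 (R : realType) (m n k r : nat)
  (A : nat -> 'M[R[i]]_n) (B : 'M[R[i]]_(n, r))
  (C : 'M[R[i]]_(r, n)) (D : nat -> 'M[R[i]]_r)
  (m_ge1 : (1 <= m)%N) (A_deg : A m != 0) (A_regular : \det (matpoly m A) != 0)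
  (k_ge1 : (1 <= k)%N) (D_deg : D k != 0)
  (h : nat) (sigma tau sigma1 sigma2 tau1 tau2 : seq int)
  (XA1 XA2 YA1 YA2 : seq 'M[R[i]]_n)
  (l : nat) (gamma delta gamma1 gamma2 delta1 delta2 : seq int)
  (XD1 XD2 YD1 YD2 : seq 'M[R[i]]_r)
  (dataA : gfpr_data m h sigma tau sigma1 sigma2 tau1 tau2 XA1 XA2 YA1 YA2)
  (dataD : gfpr_data k l gamma delta gamma1 gamma2 delta1 delta2
             XD1 XD2 YD1 YD2)
  (XA1_ns : nonsingular_assignment m sigma1 XA1)
  (XA2_ns : nonsingular_assignment m sigma2 XA2)
  (YA1_ns : nonsingular_assignment m tau1 YA1)
  (YA2_ns : nonsingular_assignment m tau2 YA2)
  (XD1_ns : nonsingular_assignment k gamma1 XD1)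
  (XD2_ns : nonsingular_assignment k gamma2 XD2)
  (YD1_ns : nonsingular_assignment k delta1 YD1)
  (YD2_ns : nonsingular_assignment k delta2 YD2) :
  rosenbrock_linearization A B C D
    (block_mx
       (gfpr_diag m A sigma tau sigma1 sigma2 tau1 tau2 XA1 XA2 YA1 YA2)
       (map_mx polyC
          ((std_col _ m (m - inversions0 (sigma1 ++ sigma))
            *m (std_col _ k (k - consecutions0 (gamma ++ gamma2)))^T)
           *t (- B)))
       (map_mx polyC
          ((std_col _ k (k - inversions0 (gamma1 ++ gamma))
            *m (std_col _ m (m - consecutions0 (sigma ++ sigma2)))^T)
           *t C))
       (gfpr_diag k D gamma delta gamma1 gamma2 delta1 delta2
          XD1 XD2 YD1 YD2)).
Proof.
split.
  move=> i j; case: (split_ordP i) => i' ->; case: (split_ordP j) => j' ->;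
  rewrite ?(block_mxEul, block_mxEur, block_mxEdl, block_mxEdr);
  by rewrite ?gfpr_is_pencil // mxE (leq_trans (size_polyC_leq1 _)).
clear A_deg A_regular D_deg.
case: m m_ge1 dataA XA1_ns XA2_ns YA1_ns YA2_ns => // m _ dA nA1 nA2 nA3 nA4.
case: k k_ge1 dataD XD1_ns XD2_ns YD1_ns YD2_ns => // k _ dD nD1 nD2 nD3 nD4.
have iA := gfpr_inversions0 dA; have cA := gfpr_consecutions0 dA.
have iD := gfpr_inversions0 dD; have cD := gfpr_consecutions0 dD.
have hA := gfpr_h dA; have hD := gfpr_h dD.
rewrite !tens_block_unit ?(leq_ltn_trans _ hA) ?(leq_ltn_trans _ hD) //.
rewrite !map_mxM -!map_trmx !map_block_unit.
have [SA [TA [uA vA ->]]] := gfpr_reduces A dA nA1 nA2 nA3 nA4.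
have [SD [TD [uD vD ->]]] := gfpr_reduces D dD nD1 nD2 nD3 nD4.
rewrite !subn1 /=.
have e : (m * n + n = n + m * n)%N by rewrite addnC.
exact: (assemble _ _ _ _ (unitmx_row_swap e uA) (unitmx_col_swap e vA) uD vD).
Qed.
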